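(* Let $\alpha\in[0,1)$. Let $G$ be a connected graph with $k$ edge-disjoint nontrivial induced subgraphs $G_1,\dots,G_k$ such that $V(G_i)\cap V(G_j)=\{u\}$ for $1\le i<j\le k$ and $\bigcup_{i=1}^kV(G_i)=V(G)$, where $k\ge 3$. Let $K$ be a nonempty subset of $\{3,\dots,k\}$ and let $N_K=\bigcup_{i\in K}N_{G_i}(u)$. For $v'\in V(G_1)\setminus\{u\}$ and $v''\in V(G_2)\setminus\{u\}$, let \[ G'=G-\{uw:w\in N_K\}+\{v'w:w\in N_K\} \] and \[ G''=G-\{uw:w\in N_K\}+\{v''w:w\in N_K\}. \] Then $\mu_{\alpha}(G)<\mu_{\alpha}(G')$ or $\mu_{\alpha}(G)<\mu_{\alpha}(G'')$.
   Context: All graphs are finite, simple and undirected; $d_G(u,v)$ is the distance between $u$ and $v$ in the connected graph $G$. A graph is nontrivial if it has at least two vertices. $N_H(u)$ is the set of neighbors of $u$ in $H$. For a set $E'$ of edges of $G$, $G-E'$ is obtained by deleting the edges in $E'$; for a set $E'$ of edges of the complement, $G+E'$ is obtained by adding the edges in $E'$. For a connected graph $G$, the transmission of a vertex $u$ is $T_G(u)=\sum_{v\in V(G)}d_G(u,v)$, $T(G)$ is the diagonal matrix of transmissions and $D(G)=(d_G(u,v))_{u,v\in V(G)}$ the distance matrix. For $\alpha\in[0,1)$, $D_{\alpha}(G)=\alpha T(G)+(1-\alpha)D(G)$, and $\mu_{\alpha}(G)$ (the distance $\alpha$-spectral radius) is the largest eigenvalue of the symmetric matrix $D_{\alpha}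(G)$.
   Formalization: It is additionally assumed that every edge of G lies in some G_i (E(G) is the union of the E(G_i)); without this the claim fails, e.g. for the triangle u, v', v'' with a pendant vertex w at u and K={3}, where G' and G'' are isomorphic to G. *)

(* Defs.v *)
From HB Require Import structures.
From mathcomp Require Import all_boot all_order all_algebra.
From mathcomp Require Import boolp classical_sets reals.
From mathcomp Require Import complex.
Set Implicit Arguments.
Unset Strict Implicit.
Unset Printing Implicit Defensive.
Import Order.TTheory GRing.Theory Num.Theory.
Local Open Scope ring_scope.

Record sgraph (T : finType) := SGraph {
  adj :> rel T;
  adj_sym : symmetric adj;
  adj_irr : irreflexive adj }.

Section Graphs.
Variable T : finType.
Implicit Types (G : sgraph T) (S : {set T}) (E : {set {set T}}).

(* An edge is the two-element set of its ends. *)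
Definition edges G : {set {set T}} :=
  [set [set x; y] | x in T, y in T & G x y].

Lemma edgesP G x y : ([set x; y] \in edges G) = G x y.
Proof.
apply/idP/idP => [/imset2P[a b _]|Gxy]; last first.
  by apply/imset2P; exists x y => //; rewrite inE.
rewrite inE /= => Gab eq_xy.
have ab : a != b by apply/eqP => ab; move: Gab; rewrite ab (adj_irr G).
have : a \in [set x; y] by rewrite eq_xy !inE eqxx.
have : b \in [set x; y] by rewrite eq_xy !inE eqxx orbT.
rewrite !inE => /orP[]/eqP bE /orP[]/eqP aE; rewrite aE bE ?eqxx // in Gab ab.
by rewrite (adj_sym G).
Qed.

Definition connected_graph G := forall x y, connect G x y.

Definition walk_len G x y n :=
  [exists p : n.-tuple T, path G x p && (last x p == y)].

(* The value is #|T| when there is no walk from x to y. *)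
Definition gdist G x y : nat := find (walk_len G x y) (iota 0 #|T|).

Lemma gdist_walk G x y : connect G x y ->
  exists2 p, path G x p /\ last x p = y & size p = gdist G x y.
Proof.
case/connectP=> q /shortenP[p pP p_uniq _] ly.
have lt_p : (size p < #|T|)%N by rewrite -[(size p).+1]/(size (x :: p)) -(card_uniqP p_uniq) max_card.
have h : has (walk_len G x y) (iota 0 #|T|).
  apply/hasP; exists (size p); first by rewrite mem_iota.
  by apply/existsP; exists (in_tuple p); rewrite pP ly eqxx.
have := nth_find 0%N h; rewrite nth_iota; last by move: h; rewrite has_find size_iota.
by case/existsP=> t /andP[tP /eqP tl]; exists t => //; rewrite size_tuple.
Qed.

Lemma gdist_le G x p : path G x p -> (gdist G x (last x p) <= size p)%N.
Proof.
move=> pP; rewrite leqNgt; apply/negP => lt_p.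
have := before_find 0%N lt_p; rewrite nth_iota ?add0n; last first.
  by apply: (leq_trans lt_p); rewrite -[leqRHS](size_iota 0) find_size.
move/negbT/negP; apply; apply/existsP.
by exists (in_tuple p); rewrite pP eqxx.
Qed.

Definition transmission G x : nat := (\sum_(y : T) gdist G x y)%N.

(* Edge set, and neighbours of x, in the subgraph of G induced by S. *)
Definition induced_edges G S : {set {set T}} := [set e in edges G | e \subset S].
Definition induced_nbrs G S x : {set T} := [set w in S | (x \in S) && G x w].

Definition del_adj G E : rel T := fun x y => G x y && ([set x; y] \notin E).
Fact del_adj_sym G E : symmetric (del_adj G E).
Proof. by move=> x y; rewrite /del_adj (adj_sym G) finset.setUC. Qed.
Fact del_adj_irr G E : irreflexive (del_adj G E).
Proof. by move=> x; rewrite /del_adj (adj_irr G). Qed.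
Definition del_edges G E : sgraph T := SGraph (del_adj_sym G E) (del_adj_irr G E).

Definition add_adj G E : rel T :=
  fun x y => G x y || (x != y) && ([set x; y] \in E).
Fact add_adj_sym G E : symmetric (add_adj G E).
Proof. by move=> x y; rewrite /add_adj (adj_sym G) finset.setUC eq_sym. Qed.
Fact add_adj_irr G E : irreflexive (add_adj G E).
Proof. by move=> x; rewrite /add_adj (adj_irr G) eqxx. Qed.
Definition add_edges G E : sgraph T := SGraph (add_adj_sym G E) (add_adj_irr G E).

End Graphs.

Section Spectrum.
Variable R : realType.

Definition is_largest_eigenvalue n (A : 'M[R]_n) (m : R) :=
  eigenvalue A m /\ forall a, eigenvalue A a -> a <= m.

Definition largest_eigenvalue n (A : 'M[R]_n) : R :=
  xget 0 [set m : R | is_largest_eigenvalue A m]%classic.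

Lemma largest_eigenvalueP n (A : 'M[R]_n) : (0 < n)%N -> A^T = A ->
  is_largest_eigenvalue A (largest_eigenvalue A).
Proof.
move=> n_gt0 symA; rewrite /largest_eigenvalue.
apply: (@xgetPex _ 0 [set m : R | is_largest_eigenvalue A m]%classic) => /=.
pose f := real_complex R; pose B := map_mx f A.
have [r rE] := closed_field_poly_normal (char_poly B).
rewrite (monicP (char_poly_monic B)) scale1r in rE.
have memr z : eigenvalue B z = (z \in r).
  by rewrite eigenvalue_root_char rE root_prod_XsubC.
have fconj (x : R) : (f x)^* = f x by rewrite /f /= -[LHS]/(_ +i* _)%C oppr0.
have real_eig z : eigenvalue B z -> z = f (complex.Re z).
  case/eigenvalueP => v vB v0.
  pose w := (map_mx Num.conj v)^T.
  have sE : (v *m w) 0 0 = \sum_j `|v 0 j| ^+ 2.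
    by rewrite mxE; apply: eq_bigr => j _; rewrite !mxE normCK.
  have s0 : (v *m w) 0 0 != 0.
    rewrite sE psumr_eq0 => [|j _]; last exact: exprn_ge0.
    apply: contra v0 => /allP v0; apply/eqP/rowP => j; rewrite mxE.
    by have := v0 j (mem_index_enum _); rewrite sqrf_eq0 normr_eq0 => /eqP.
  have hB : map_mx Num.conj B = B by apply/matrixP => i j; rewrite !mxE fconj.
  have sB : B^T = B by apply/matrixP => i j; rewrite !mxE -{1}symA mxE.
  have wB : B *m w = z^* *: w.
    rewrite -{1}sB -trmx_mul -{1}hB -map_mxM vB.
    by apply/matrixP => i j; rewrite !mxE rmorphM.
  have : v *m B *m w = v *m (B *m w) by rewrite mulmxA.
  rewrite vB wB -scalemxAl -scalemxAr => /matrixP/(_ 0 0); rewrite [LHS]mxE [RHS]mxE.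
  move/(mulIf s0) => /eqP zz.
  by case: z {vB wB} zz => a b; rewrite eq_complex /= => /andP[_ /eqP bE];
    congr (_ +i* _)%C; apply/eqP; rewrite -[_ == _](mulrn_eq0 b 2) mulr2n {1}bE addNr.
have eigE a : eigenvalue A a = (f a \in r) by rewrite -memr eigenvalue_map.
have r0 : r != [::].
  apply: contraTneq n_gt0 => r0; have := size_char_poly B.
  by rewrite rE r0 big_nil size_poly1 => -[<-].
pose s := [seq complex.Re z | z <- r].
have rs z : z \in r -> eigenvalue A (complex.Re z).
  by move=> zr; rewrite eigE -real_eig ?memr.
case: r r0 @s rs eigE {memr rE} => // z0 r _ s rs eigE.
have [i _ iP] := @arg_maxP _ _ _ (ord0 : 'I_(size r).+1) predT
  (fun i => complex.Re (nth z0 (z0 :: r) i)) isT.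
exists (complex.Re (nth z0 (z0 :: r) i)); split; first by apply/rs/mem_nth.
move=> a; rewrite eigE => /(nthP z0)[j jr jE].
by have := iP (Ordinal jr) isT; rewrite /= jE.
Qed.

(* Rows and columns are indexed by the vertices through enum_val. *)
Definition dist_alpha_mx (T : finType) (alpha : R) (G : sgraph T) : 'M[R]_#|T| :=
  let Tr : 'M[R]_#|T| := diag_mx (\row_i (transmission G (enum_val i))%:R) in
  let D : 'M[R]_#|T| := \matrix_(i, j) (gdist G (enum_val i) (enum_val j))%:R in
  alpha *: Tr + (1 - alpha) *: D.

Definition mu_alpha (T : finType) (alpha : R) (G : sgraph T) : R :=
  largest_eigenvalue (dist_alpha_mx alpha G).

End Spectrum.

(* Main.v *)
(* Every entry of D_alpha(G) off the diagonal is positive, so mu(G) is the value of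
   the quadratic form of D_alpha(G) at a positive unit vector f, while mu(H) bounds the
   form of D_alpha(H) for every H.  Let A be the union of the V(G_i) \ u, i in K, and
   Q(y) > 0 the weight in the form of the distances from A to a vertex y not in A.
   Attaching A to v' in G_1 instead of u moves A away from y by exactly d(u,v') when y
   is outside G_1 or y = u, brings it closer to y by at most d(u,v') when y is another
   vertex of G_1, and changes no other distance.  Hence the form at f grows by at least
   d(u,v') * Z_1, where Z_1 (below [cross_weight A f B]) sums Q(y) with
   sign -1 on G_1 \ u and +1 elsewhere.  Likewise for v'' with Z_2, and Z_1 + Z_2 >= 2 Q(u) > 0 since G_1 \ u and G_2 \ u
   are disjoint, so that Z_1 > 0 or Z_2 > 0. *)
Require Import Defs.
From mathcomp Require Import all_boot all_order all_algebra.
From mathcomp Require Import reals.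
From mathcomp Require Import complex zify ring lra.
Set Implicit Arguments.
Unset Strict Implicit.
Unset Printing Implicit Defensive.
Import Order.TTheory GRing.Theory Num.Theory.
Local Open Scope ring_scope.

(** * Rayleigh quotients of real symmetric matrices and a Perron vector *)

Section Rayleigh.
Variables (R : rcfType) (n : nat) (A : 'M[R]_n) (m : R).
Hypotheses (symA : A^T = A) (m_ub : forall a, eigenvalue A a -> a <= m).

(** The spectral theorem over the complex numbers diagonalizes [A]. In an orthonormal eigenbasis the
    form is a combination of squared moduli whose coefficients are eigenvalues, each at most [m]. *)
Lemma rayleigh_le (v : 'rV[R]_n) :
  (v *m A *m v^T) 0 0 <= m * (v *m v^T) 0 0.
Proof.
pose f := real_complex R; pose B := map_mx f A.
have f_real x : f x \is Num.real by apply/CrealP; rewrite /f /= -[LHS]/(_ +i* _)%C oppr0.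
have hermB : B \is hermsymmx.
  apply: realsym_hermsym; last by apply/mxOverP => i j; rewrite mxE.
  apply/is_hermitianmxP; rewrite expr0 scale1r map_mx_id //.
  by rewrite map_trmx symA.
have D_real := hermitian_spectral_diag_real hermB.
have /orthomx_spectralP := hermitian_normalmx hermB.
have U := spectral_unitarymx B.
set P := spectralmx B in U *; set D := spectral_diag B in D_real *.
move=> BE; have Pu := unitarymx_unit U.
(* Row [j] of [P] is an eigenvector for [D 0 j], nonzero because [P] is invertible. As [D 0 j] is
   real, it is an eigenvalue of [A] itself. *)
have D_eig j : D 0 j <= f m.
  have /complex_realP[x Dx] : D 0 j \is Num.real by apply: (mxOverP D_real).
  rewrite Dx -[_ <= _]/((real_complex R x) <= (real_complex R m)) lecR.
  apply: m_ub; rewrite -(eigenvalue_map f); apply/eigenvalueP.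
  exists (row j P).
    rewrite -/B [B]BE -row_mul !mulmxA mulmxV // mul1mx.
    by rewrite mul_diag_mx; apply/rowP => l; rewrite !mxE Dx.
  apply: contraTneq Pu => Pj0; rewrite -row_free_unit; apply/row_freeP => -[Q PQ].
  have /rowP/(_ j) := congr1 (row j) PQ.
  by rewrite row_mul Pj0 mul0mx !mxE eqxx => /esym/eqP; rewrite oner_eq0.
(* [c] holds the coordinates of [v] in the eigenbasis formed by the rows of [P]. *)
pose w := map_mx f v; pose c := w *m map_mx Num.conj P^T.
have fconj x : (f x)^* = f x by apply/CrealP.
have wT : map_mx Num.conj w^T = map_mx f v^T.
  by apply/matrixP => i j; rewrite !mxE fconj.
have cT : map_mx Num.conj c^T = P *m map_mx f v^T.
  by rewrite trmx_mul map_mxM wT map_trmx trmxK -map_mx_comp map_mx_id // => x; apply: conjCK.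
have formE : f ((v *m A *m v^T) 0 0) = \sum_j D 0 j * `|c 0 j| ^+ 2.
  transitivity ((w *m B *m map_mx f v^T) 0 0); first by rewrite -!map_mxM [RHS]mxE.
  rewrite BE invmx_unitary // !mulmxA -/c -mulmxA -cT mxE; apply: eq_bigr => j _.
  by rewrite mul_mx_diag !mxE normCK mulrCA mulrA.
have normE : f ((v *m v^T) 0 0) = \sum_j `|c 0 j| ^+ 2.
  transitivity ((w *m map_mx f v^T) 0 0); first by rewrite -!map_mxM [RHS]mxE.
  have -> : w = c *m P by rewrite /c mulmxKtV.
  by rewrite -mulmxA -cT mxE; apply: eq_bigr => j _; rewrite !mxE normCK.
suff : f ((v *m A *m v^T) 0 0) <= f m * f ((v *m v^T) 0 0).
  by rewrite -(rmorphM (real_complex R)) lecR.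
rewrite formE normE mulr_sumr.
by apply: ler_sum => j _; rewrite ler_wpM2r // exprn_ge0.
Qed.

(* [m x x^T - x A x^T] is nonnegative and vanishes at [v], so its derivative at [v]
   in the direction [v A - m v], which is [-2 |v A - m v|^2], is zero. *)
Lemma rayleigh_eq (v : 'rV[R]_n) :
  (v *m A *m v^T) 0 0 = m * (v *m v^T) 0 0 -> v *m A = m *: v.
Proof.
move=> vE; apply/eqP; rewrite -subr_eq0; set z := v *m A - m *: v.
have vAE : v *m A = m *: v + z by rewrite addrC subrK.
clearbody z.
have zzE : (z *m z^T) 0 0 = \sum_j (z 0 j) ^+ 2.
  by rewrite mxE; apply: eq_bigr => j _; rewrite mxE expr2.
have symf (x y : 'rV[R]_n) : (x *m y^T) 0 0 = (y *m x^T) 0 0.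
  by rewrite !mxE; apply: eq_bigr => j _; rewrite !mxE mulrC.
have zE : (v *m A *m z^T) 0 0 = m * (v *m z^T) 0 0 + (z *m z^T) 0 0.
  by rewrite vAE mulmxDl -scalemxAl [LHS]mxE [X in X + _]mxE.
have zE' : (z *m A *m v^T) 0 0 = (v *m A *m z^T) 0 0.
  by rewrite -mulmxA -{1}symA -trmx_mul symf.
pose c := m * (z *m z^T) 0 0 - (z *m A *m z^T) 0 0.
have c_ge0 : 0 <= c by rewrite subr_ge0 rayleigh_le.
have key t : 0 <= t ^+ 2 * c - 2 * t * (z *m z^T) 0 0.
  have := rayleigh_le (v + t *: z); rewrite -subr_ge0; congr (_ <= _).
  have addE (X Y : 'M[R]_1) : (X + Y) 0 0 = X 0 0 + Y 0 0 by rewrite mxE.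
  have scaleE a (X : 'M[R]_1) : (a *: X) 0 0 = a * X 0 0 by rewrite mxE.
  rewrite linearD linearZ /= !mulmxDl !mulmxDr -!scalemxAl -!scalemxAr !addE !scaleE.
  by rewrite zE' zE vE (symf z v) /c; ring.
have s_ge0 : 0 <= (z *m z^T) 0 0 by rewrite zzE sumr_ge0 // => j _; rewrite sqr_ge0.
have : (z *m z^T) 0 0 = 0.
  (* With [s] the squared norm of [z], the minimum over [t] is at [s / c]; the denominator [c + 1]
     also covers [c = 0] and still makes the value negative unless [s = 0]. *)
  have := key ((z *m z^T) 0 0 / (c + 1)).
  set s := (z *m z^T) 0 0 in s_ge0 *.
  have c1_gt0 : 0 < c + 1 by rewrite ltr_wpDl.
  have -> : (s / (c + 1)) ^+ 2 * c - 2 * (s / (c + 1)) * s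
          = - (s / (c + 1)) ^+ 2 * (c + 2) by field; rewrite gt_eqF.
  rewrite mulNr oppr_ge0 pmulr_lle0 ?ltr_wpDl // real_exprn_even_le0 ?num_real //=.
  by rewrite mulf_eq0 invr_eq0 (gt_eqF c1_gt0) orbF => /eqP.
rewrite zzE => /eqP; rewrite psumr_eq0 => [|j _]; last exact: sqr_ge0.
move=> /allP z0; apply/eqP/rowP => j; rewrite mxE.
by apply/eqP; rewrite -sqrf_eq0; exact: z0 (mem_index_enum j).
Qed.

(** Taking absolute values in an eigenvector keeps the norm and does not lower the form, the
    diagonal terms being unchanged, so by [rayleigh_eq] the result is again an eigenvector. A zero
    entry at [i] would make coordinate [i] of the eigenvalue equation a vanishing sum of nonnegative
    terms, forcing the whole vector to be zero. *)
Lemma perron_vector : eigenvalue A m -> (forall i j, i != j -> 0 < A i j) ->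
  exists2 v : 'rV[R]_n, forall i, 0 < v 0 i & v *m A = m *: v.
Proof.
move=> /eigenvalueP[v vA v0] A_gt0.
pose w := map_mx Num.norm v.
have wwE : (w *m w^T) 0 0 = (v *m v^T) 0 0.
  by rewrite !mxE; apply: eq_bigr => j _; rewrite !mxE -normrM -expr2 ger0_norm ?sqr_ge0.
have vle : (v *m A *m v^T) 0 0 <= (w *m A *m w^T) 0 0.
  rewrite !mxE; apply: ler_sum => j _; rewrite !mxE !mulr_suml; apply: ler_sum => i _.
  rewrite !mxE; have [->|ij] := eqVneq i j.
    by rewrite !(mulrAC _ (A j j)) -normrM -!expr2 ger0_norm ?sqr_ge0.
  by apply: le_trans (ler_norm _) _; rewrite !normrM (gtr0_norm (A_gt0 _ _ ij)).
have wA : w *m A = m *: w.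
  apply: rayleigh_eq; apply/eqP; rewrite eq_le rayleigh_le wwE; apply: le_trans vle.
  by rewrite vA -scalemxAl [leRHS]mxE.
have wE i : w 0 i = `|v 0 i| by rewrite mxE.
exists w => // i; rewrite lt_neqAle wE normr_ge0 andbT eq_sym normr_eq0.
apply: contra v0 => /eqP vi0; apply/eqP/rowP => j; rewrite [RHS]mxE.
have /rowP/(_ i) := wA; rewrite [RHS]mxE wE vi0 normr0 mulr0 mxE => /eqP.
rewrite psumr_eq0 => [/allP/(_ j (mem_index_enum j))|l _]; last first.
  have [->|li] := eqVneq l i; first by rewrite wE vi0 normr0 mul0r.
  by rewrite wE mulr_ge0 // ltW // A_gt0.
have [->|ji] := eqVneq j i; first by move=> _.
by rewrite wE mulf_eq0 normr_eq0 (gt_eqF (A_gt0 _ _ ji)) orbF => /eqP.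
Qed.

End Rayleigh.

(** * Graph distance and cut vertices *)

Section Distance.
Variables (T : finType) (G : sgraph T).

(** Follow a shortest walk. A potential [h] tailored to the situation thus gives a lower bound on a
    distance without any surgery on walks. *)
Lemma lipschitz_gdist (h : T -> nat) x y : connect G x y ->
  (forall a b, G a b -> (h b <= (h a).+1)%N) -> (h y <= h x + gdist G x y)%N.
Proof.
move=> /gdist_walk[p [pP <-] <-] h_lip; elim: p x pP => /= [|z p IHp] x.
  by rewrite addn0.
move=> /andP[/h_lip hz /IHp]; lia.
Qed.

Lemma gdistxx x : gdist G x x = 0%N.
Proof. by have := @gdist_le _ G x [::] isT; rewrite leqn0 => /eqP. Qed.

Hypothesis Gconn : connected_graph G.

Lemma gdist_eq0 x y : (gdist G x y == 0%N) = (x == y).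
Proof.
apply/eqP/eqP => [|->]; last exact: gdistxx.
by have [p [_ <-] <-] := gdist_walk (Gconn x y) => /size0nil ->.
Qed.

Lemma gdist_sym x y : gdist G x y = gdist G y x.
Proof.
wlog suff le_d : x y / (gdist G y x <= gdist G x y)%N.
  by apply/eqP; rewrite eqn_leq !le_d.
have [p [pP <-] <-] := gdist_walk (Gconn x y).
have eqG : (fun z => G^~ z) =2 G by move=> a b; rewrite (adj_sym G).
have := @gdist_le _ G (last x p) (rev (belast x p)).
rewrite rev_path (eq_path eqG) size_rev size_belast => /(_ pP).
by congr (gdist _ _ _ <= _)%N; case: p {pP} => //= a p; rewrite rev_cons last_rcons.
Qed.

Lemma gdist_step x a b : G a b -> (gdist G x b <= (gdist G x a).+1)%N.
Proof.
have [p [pP <-] <-] := gdist_walk (Gconn x a) => Gab.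
have := @gdist_le _ G x (rcons p b).
by rewrite rcons_path pP last_rcons size_rcons; apply.
Qed.

Lemma gdist_step_sym x a b : G a b -> (gdist G b x <= (gdist G a x).+1)%N.
Proof. by rewrite !(gdist_sym _ x); exact: gdist_step. Qed.

Lemma gdist_adj a b : G a b -> gdist G a b = 1%N.
Proof.
move=> Gab; have := gdist_step a Gab; rewrite gdistxx.
have := gdist_eq0 a b; case: (eqVneq a b) => [ab|_]; last lia.
by rewrite ab (adj_irr G) in Gab.
Qed.

Lemma gdist_triangle y x z : (gdist G x z <= gdist G x y + gdist G y z)%N.
Proof. by apply: lipschitz_gdist => [|a b]; [exact: Gconn | exact: gdist_step]. Qed.

(** Equivalently, [A] is a union of connected components of [G] with [u] removed. *)
Definition attached (u : T) (A : {set T}) :=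
  u \notin A /\ forall x y, x \in A -> y \notin A -> G x y -> y = u.

(** Any walk leaving [A] passes through [u]. The potential [h] is the length of the route to [y],
    forced through [u] on [A]; it vanishes at [y]. *)
Lemma attached_gdist u A x y : attached u A -> x \in A -> y \notin A ->
  (gdist G x u + gdist G u y <= gdist G x y)%N.
Proof.
move=> [uA uP] xA yA.
pose h z := if z \in A then (gdist G z u + gdist G u y)%N else gdist G z y.
have : (h x <= h y + gdist G y x)%N.
  apply: lipschitz_gdist => [|a b Gab]; first exact: Gconn.
  have stepu := gdist_step_sym u Gab; have stepy := gdist_step_sym y Gab.
  rewrite /h; case: ifPn => bA; case: ifPn => aA //; first lia.
    have := uP b a bA aA; rewrite (adj_sym G) => /(_ Gab) ea.
    by subst a; rewrite gdistxx in stepu; lia.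
  by rewrite (uP a b aA bA Gab); lia.
by rewrite /h xA (negPf yA) gdistxx (gdist_sym y x).
Qed.

End Distance.

(** * Moving a branch from [u] to [v], and the resulting distances *)

Section Relocation.
Variables (T : finType) (G : sgraph T).

Lemma mem_star (N : {set T}) a b c :
  ([set a; b] \in [set [set c; w] | w in N]) =
  (a == c) && (b \in N) || (b == c) && (a \in N).
Proof.
apply/imsetP/orP => [[w wN abE]|[]/andP[/eqP-> xN]]; last 2 first.
- by exists b.
- by exists a; rewrite // finset.setUC.
have : a \in [set c; w] by rewrite -abE !inE eqxx.
have : b \in [set c; w] by rewrite -abE !inE eqxx orbT.
have : c \in [set a; b] by rewrite abE !inE eqxx.
have : w \in [set a; b] by rewrite abE !inE eqxx orbT.
rewrite !inE => /orP[]/eqP wE /orP[]/eqP cE; subst w c; rewrite ?eqxx ?wN ?orbb.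
- by move=> /eqP ->; rewrite eqxx wN; left.
- by right.
- by left.
- by move=> _ /eqP ->; rewrite eqxx wN; left.
Qed.

Definition relocate (u v : T) (N : {set T}) : sgraph T :=
  add_edges (del_edges G [set [set u; w] | w in N]) [set [set v; w] | w in N].

Variables (u v : T) (A : {set T}).
Hypotheses (Gconn : connected_graph G) (uA : attached G u A) (vA : v \notin A).
Let G' := relocate u v [set w in A | G u w].

(** Every edge between [A] and its complement ends at [u], so the deletion removes all of them and
    only the new edges at [v] cross. *)
Lemma relocateE a b : G' a b =
  if (a \in A) == (b \in A) then G a b
  else if a \in A then (b == v) && G u a else (a == v) && G u b.
Proof.
have [u_A uP] := uA.
rewrite /= /add_adj /= /del_adj !mem_star !inE.
have nu c : c \in A -> (c == u) = false by move=> cA; apply: contraNF u_A => /eqP <-.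
have nv c : c \in A -> (c == v) = false by move=> cA; apply: contraNF vA => /eqP <-.
have nab c d : c \in A -> d \notin A -> c != d by move=> cA; apply: contraNneq => <-.
have Gab c d : c \in A -> d \notin A -> G c d && (d != u) = false.
  by move=> cA dA; case: (boolP (G c d)) => // /(uP _ _ cA dA) ->; rewrite eqxx.
case: (boolP (a \in A)) => aA; case: (boolP (b \in A)) => bA;
  rewrite /= ?andbF ?andbT ?orbF //=.
- by rewrite !nu // !nv // !andbF !orbF andbT.
- rewrite nab //=.
  have -> : G a b && ~~ ((b == u) && G u a) = G a b && (b != u).
    by case: (eqVneq b u) => [->|] //; rewrite (adj_sym G) andbN andbF.
  by rewrite Gab.
- rewrite [a == b]eq_sym nab //=.
  have -> : G a b && ~~ ((a == u) && G u b) = G b a && (a != u).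
    by case: (eqVneq a u) => [->|]; rewrite (adj_sym G) //= andbC andNb andbF.
  by rewrite Gab.
Qed.

Lemma relocate_adj a b : (a \in A) = (b \in A) -> G a b -> G' a b.
Proof. by move=> ab; rewrite relocateE ab eqxx. Qed.

(** Outside [A], induction on the distance from [u] applies: a shortest walk steps out of [A] only
    at [u]. An old edge from [A] to [u] is replaced by an edge to [v] followed by a walk from [v] to
    [u]. *)
Lemma relocate_connected : connected_graph G'.
Proof.
have [u_A uP] := uA.
have csym : connect_sym G' by apply/sym_connect_sym/(adj_sym G').
have cu n y : (gdist G u y <= n)%N -> y \notin A -> connect G' u y.
  elim: n y => [|n IHn] y.
    by rewrite leqn0 (gdist_eq0 Gconn) => /eqP ->.
  have [p [pP <-] <-] := gdist_walk (Gconn u y).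
  case/lastP: p pP => [//|p z]; rewrite rcons_path last_rcons size_rcons ltnS.
  move=> /andP[pP Gz] le_p zA.
  have le_d := leq_trans (gdist_le pP) le_p.
  case: (boolP (last u p \in A)) => lA; first by rewrite (uP _ _ lA zA Gz).
  apply: connect_trans (IHn _ le_d lA) (connect1 _).
  by rewrite relocate_adj // (negPf zA) (negPf lA).
have step a b : G a b -> connect G' a b.
  move=> Gab; case: (eqVneq (a \in A) (b \in A)) => ab.
    exact/connect1/relocate_adj.
  wlog aA : a b Gab ab / a \in A.
    move=> H; case: (boolP (a \in A)) => aA; first exact: H.
    rewrite csym; apply: H; first by rewrite (adj_sym G).
      by rewrite eq_sym.
    by move: ab; rewrite (negPf aA); case: (b \in A).
  have bA : b \notin A by move: ab; rewrite aA; case: (b \in A).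
  have bu := uP _ _ aA bA Gab; subst b.
  apply: (@connect_trans _ _ v); last by rewrite csym; exact: cu (leqnn _) vA.
  by apply: connect1; rewrite relocateE aA (negPf vA) eqxx /= (adj_sym G).
move=> x y; have /connectP[p pP ->] := Gconn x y.
elim: p x pP => [|z p IHp] x /=; first by rewrite connect0.
by move=> /andP[/step Gxz /IHp]; apply: connect_trans.
Qed.

(** In [G'] the only exit from [A] is through [v], entered from a former neighbour of [u]; hence [h]
    grows by at most one along each edge of [G']. *)
Lemma relocate_gdist_in a y : a \in A ->
  ((if y \in A then gdist G a y else gdist G a u + gdist G v y) <= gdist G' a y)%N.
Proof.
move=> aA; pose h z := if z \in A then gdist G a z else (gdist G a u + gdist G v z)%N.
have := @lipschitz_gdist _ G' h a y (relocate_connected a y).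
rewrite /h aA gdistxx; apply=> b c; rewrite relocateE.
case: (boolP (b \in A)) => bA; case: (boolP (c \in A)) => cA /=.
- exact: gdist_step.
- by move=> /andP[/eqP -> Gub]; rewrite gdistxx addn0 gdist_step // (adj_sym G).
- by move=> /andP[/eqP -> Guc]; rewrite gdistxx addn0 gdist_step.
- by rewrite -addnS leq_add2l; exact: gdist_step.
Qed.

(** A detour into [A] enters and leaves at [v], so it cannot shorten a walk. On [A] the potential
    measures the route from [x] that enters at [v]. *)
Lemma relocate_gdist_out x y : x \notin A -> y \notin A ->
  (gdist G x y <= gdist G' x y)%N.
Proof.
move=> xA yA; pose h z := if z \in A then (gdist G x v + gdist G u z)%N else gdist G x z.
have := @lipschitz_gdist _ G' h x y (relocate_connected x y).
rewrite /h (negPf xA) (negPf yA) gdistxx; apply=> b c; rewrite relocateE.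
case: (boolP (b \in A)) => bA; case: (boolP (c \in A)) => cA /=.
- by rewrite -addnS leq_add2l; exact: gdist_step.
- by move=> /andP[/eqP -> Gub]; lia.
- by move=> /andP[/eqP -> Guc]; rewrite (gdist_adj Gconn Guc) addn1.
- exact: gdist_step.
Qed.

End Relocation.

(** * The quadratic form of the distance matrix and its change under relocation *)

Section QuadraticForm.
Variables (R : realType) (alpha : R) (T : finType).
Hypothesis halpha : 0 <= alpha < 1.
Implicit Types (G : sgraph T) (f : T -> R).

(** The coefficient of the distance from [x] to [y] in the form. It is not symmetric in [x] and [y],
    so [cross_weight] adds both orders. *)
Definition pair_weight f x y : R := alpha * f x ^+ 2 + (1 - alpha) * (f x * f y).

Definition dist_form G f : R := \sum_x \sum_y (gdist G x y)%:R * pair_weight f x y.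

Lemma sum_enum_val (F : T -> R) : \sum_x F x = \sum_(i < #|T|) F (enum_val i).
Proof. exact/reindex/onW_bij/enum_val_bij. Qed.

Lemma pair_weight_gt0 f x y : (forall z, 0 < f z) -> 0 < pair_weight f x y.
Proof.
move=> f_gt0; case/andP: halpha => a_ge0 a_lt1.
apply: ltr_wpDl; first by rewrite mulr_ge0 ?sqr_ge0.
by rewrite mulr_gt0 ?subr_gt0 // mulr_gt0.
Qed.

Section Spectral.
Variable G : sgraph T.
Hypothesis Gconn : connected_graph G.
Local Notation M := (dist_alpha_mx alpha G).

Lemma dist_alpha_mx_sym : M^T = M.
Proof.
apply/matrixP => i j; rewrite !mxE (gdist_sym Gconn) eq_sym.
by case: (eqVneq i j) => [->|].
Qed.

Lemma dist_alpha_mx_form f (v := \row_(i < #|T|) f (enum_val i)) :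
  (v *m M *m v^T) 0 0 = dist_form G f.
Proof.
rewrite mxE /dist_form sum_enum_val; apply: eq_bigr => j _.
rewrite sum_enum_val mulmxDr -!scalemxAr mul_mx_diag !mxE /transmission natr_sum sum_enum_val.
rewrite !mulr_sumr -big_split /= mulr_suml.
apply: eq_bigr => i _; rewrite !mxE (gdist_sym Gconn (enum_val i)) /pair_weight.
by ring.
Qed.

Lemma dist_norm f (v := \row_(i < #|T|) f (enum_val i)) :
  (v *m v^T) 0 0 = \sum_x f x ^+ 2.
Proof. by rewrite mxE sum_enum_val; apply: eq_bigr => j _; rewrite !mxE expr2. Qed.

Hypothesis T_gt0 : (0 < #|T|)%N.

Lemma dist_form_le f : dist_form G f <= mu_alpha alpha G * \sum_x f x ^+ 2.
Proof.
rewrite -dist_alpha_mx_form -dist_norm rayleigh_le ?dist_alpha_mx_sym //.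
by have [] := largest_eigenvalueP T_gt0 dist_alpha_mx_sym.
Qed.

Lemma dist_form_perron : exists2 f,
  forall x, 0 < f x & dist_form G f = mu_alpha alpha G * \sum_x f x ^+ 2.
Proof.
have [mu_eig mu_ub] := largest_eigenvalueP T_gt0 dist_alpha_mx_sym.
have [i j ij|v v_gt0 vM] := perron_vector dist_alpha_mx_sym mu_ub mu_eig.
  rewrite !mxE (negPf ij) mulr0n mulr0 add0r; case/andP: halpha => _ a_lt1.
  rewrite mulr_gt0 ?subr_gt0 // ltr0n lt0n (gdist_eq0 Gconn).
  by rewrite (inj_eq enum_val_inj).
exists (fun x => v 0 (enum_rank x)) => //.
have vE : v = \row_i v 0 (enum_rank (enum_val i)).
  by apply/rowP => i; rewrite mxE enum_valK.
by rewrite -dist_alpha_mx_form -dist_norm -vE vM -scalemxAl mxE.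
Qed.

End Spectral.

Section Gain.
Variables (G : sgraph T) (u : T) (A : {set T}) (f : T -> R).
Hypotheses (Gconn : connected_graph G) (uA : attached G u A) (f_gt0 : forall x, 0 < f x).

Definition cross_weight (B : {set T}) : R :=
  \sum_(x in A) \sum_(y in ~: A)
    (-1) ^+ (y \in B) * (pair_weight f x y + pair_weight f y x).

Lemma relocate_gain v B : attached G u B -> v \in B -> [disjoint A & B] ->
  (gdist G u v)%:R * cross_weight B <=
  dist_form (relocate G u v [set w in A | G u w]) f - dist_form G f.
Proof.
move=> uB vB dAB; set G' := relocate _ _ _ _.
have vA : v \notin A by rewrite (disjointFl dAB).
have G'conn : connected_graph G' by apply: relocate_connected.
have d_in := relocate_gdist_in Gconn uA vA.
have d_out := relocate_gdist_out Gconn uA vA.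
rewrite -/G' in d_in d_out.
pose D : R := (gdist G u v)%:R; pose s y : R := (-1) ^+ (y \in B).
pose e x y : R := (gdist G' x y)%:R - (gdist G x y)%:R.
have e_sym x y : e x y = e y x by rewrite /e (gdist_sym Gconn) (gdist_sym G'conn).
have e_same x y : (x \in A) = (y \in A) -> 0 <= e x y.
  rewrite subr_ge0 ler_nat; case: (boolP (x \in A)) => xA yA.
    by have := d_in x y xA; rewrite -yA.
  by apply: d_out => //; rewrite -yA.
have e_cross x y : x \in A -> y \notin A -> D * s y <= e x y.
  move=> xA yA; have := d_in x y xA; rewrite (negPf yA) -(ler_nat R) natrD => le1.
  have := gdist_triangle Gconn u x y; rewrite -(ler_nat R) natrD => le2.
  (* For [y] in [B] this is the triangle inequality; for [y] outside [B], the route from [v] to [y]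
     passes through [u]. *)
  have le3 : D * s y <= (gdist G v y)%:R - (gdist G u y)%:R.
    rewrite lerBrDr /s; case: (boolP (y \in B)) => yB /=.
      rewrite mulrN1 addrC lerBlDr -natrD ler_nat addnC.
      exact: gdist_triangle.
    rewrite mulr1 -natrD ler_nat (gdist_sym Gconn u v).
    exact: attached_gdist uB vB yB.
  rewrite /e; lra.
(* [g] and [h] separate the two orders of a crossing pair and extend them by zero, so that the bound
   can be checked term by term over all ordered pairs. *)
pose g x y : R := if (x \in A) && (y \in ~: A) then D * (s y * pair_weight f x y) else 0.
pose h x y : R := if (x \in A) && (y \in ~: A) then D * (s y * pair_weight f y x) else 0.
have -> : D * cross_weight B = \sum_x \sum_y (g x y + h y x).
  under [RHS]eq_bigr do rewrite big_split.
  rewrite big_split /= [X in _ + X]exchange_big -big_split /= mulr_sumr big_mkcond.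
  apply: eq_bigr => x _; rewrite -big_split /= /g /h; case: (x \in A); last first.
    by rewrite big1 // => y _; rewrite addr0.
  rewrite mulr_sumr big_mkcond; apply: eq_bigr => y _ /=.
  by case: (y \in ~: A); rewrite ?addr0 // -/(s y); ring.
rewrite /dist_form -sumrB; apply: ler_sum => x _; rewrite -sumrB; apply: ler_sum => y _.
rewrite -mulrBl -/(e x y) /g /h !inE.
have w_ge0 := ltW (pair_weight_gt0 x y f_gt0).
case: (boolP (x \in A)) => xA; case: (boolP (y \in A)) => yA /=; rewrite ?addr0 ?add0r.
- by rewrite mulr_ge0 // e_same // xA yA.
- by rewrite mulrA ler_wpM2r // e_cross.
- by rewrite mulrA ler_wpM2r // e_sym e_cross.
- by rewrite mulr_ge0 // e_same // (negPf xA) (negPf yA).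
Qed.

(** Disjointness makes the two signs at each [y] add up to 0 or 2, and they add up to 2 at
    [y = u]. *)
Lemma cross_weight_add_gt0 (B1 B2 : {set T}) : A != set0 -> [disjoint B1 & B2] ->
  u \notin B1 -> u \notin B2 -> 0 < cross_weight B1 + cross_weight B2.
Proof.
move=> /set0Pn[a aA] dB uB1 uB2; have [u_A _] := uA.
have w_gt0 x y : 0 < pair_weight f x y + pair_weight f y x.
  by rewrite addr_gt0 // pair_weight_gt0.
have s_ge0 y : 0 <= (-1) ^+ (y \in B1) + (-1) ^+ (y \in B2) :> R.
  case: (boolP (y \in B1)) => [yB|_]; first by rewrite (disjointFr dB yB) addNr.
  by case: (y \in B2); rewrite ?subrr // addr_ge0.
rewrite -big_split; under eq_bigr do rewrite -big_split.
have ge0 x y : 0 <= (-1) ^+ (y \in B1) * (pair_weight f x y + pair_weight f y x)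
    + (-1) ^+ (y \in B2) * (pair_weight f x y + pair_weight f y x).
  by rewrite -mulrDl mulr_ge0 // ltW.
rewrite (bigD1 a) //= (bigD1 u) ?inE //= (negPf uB1) (negPf uB2) !expr0 !mul1r.
rewrite ltr_wpDr ?sumr_ge0 // => [x _|]; first exact: sumr_ge0.
by rewrite ltr_wpDr ?sumr_ge0 // addr_gt0.
Qed.

End Gain.

(** The Perron vector of [G] serves as test vector for both relocated graphs, which makes their two
    gains comparable. *)
Lemma relocate_mu_lt (G : sgraph T) (u v1 v2 : T) (A B1 B2 : {set T}) :
  connected_graph G -> A != set0 ->
  attached G u A -> attached G u B1 -> attached G u B2 ->
  [disjoint A & B1] -> [disjoint A & B2] -> [disjoint B1 & B2] ->
  v1 \in B1 -> v2 \in B2 ->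
  let N := [set w in A | G u w] in
  mu_alpha alpha G < mu_alpha alpha (relocate G u v1 N) \/
  mu_alpha alpha G < mu_alpha alpha (relocate G u v2 N).
Proof.
move=> Gconn A0 uA uB1 uB2 dA1 dA2 dB v1B v2B N.
have T_gt0 : (0 < #|T|)%N by apply/card_gt0P; exists u.
have [f f_gt0 fE] := dist_form_perron Gconn T_gt0.
have norm_gt0 : 0 < \sum_x f x ^+ 2.
  by rewrite (bigD1 u) //= ltr_pwDl ?exprn_gt0 // sumr_ge0 // => x _; rewrite sqr_ge0.
have improve v B : attached G u B -> v \in B -> [disjoint A & B] ->
    0 < cross_weight A f B -> mu_alpha alpha G < mu_alpha alpha (relocate G u v N).
  move=> uB vB dAB w_gt0.
  have vA : v \notin A by rewrite (disjointFl dAB).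
  have uv : u != v by apply: contraTneq vB => <-; case: uB.
  have G'conn : connected_graph (relocate G u v N) by apply: relocate_connected.
  have form_lt : dist_form G f < dist_form (relocate G u v N) f.
    rewrite -subr_gt0; apply: lt_le_trans (relocate_gain Gconn uA f_gt0 uB vB dAB).
    by rewrite mulr_gt0 // ltr0n lt0n (gdist_eq0 Gconn).
  by have := lt_le_trans form_lt (dist_form_le G'conn T_gt0 f); rewrite fE ltr_pM2r.
have := cross_weight_add_gt0 uA f_gt0 A0 dB uB1.1 uB2.1.
case: (ltP 0 (cross_weight A f B1)) => [w1 _|w1 w12]; [left|right].
  exact: improve uB1 v1B dA1 w1.
by apply: improve uB2 v2B dA2 _; apply: lt_le_trans w12 _; rewrite gerDr.
Qed.

End QuadraticForm.

(** * Branches of a graph whose parts share the single vertex [u] *)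

Section Decomposition.
Variables (T : finType) (G : sgraph T) (k : nat) (S : 'I_k -> {set T}) (u : T).
Hypotheses (S_meet : forall i j : 'I_k, (i < j)%N -> S i :&: S j = [set u])
  (S_edges : \bigcup_(i : 'I_k) induced_edges G (S i) = edges G).
Implicit Type J : {set 'I_k}.

Definition branches J : {set T} := (\bigcup_(i in J) S i) :\ u.

Lemma part_eq x i j : x != u -> x \in S i -> x \in S j -> i = j.
Proof.
have meet (i' j' : 'I_k) : x != u -> x \in S i' -> x \in S j' -> ~~ (i' < j')%N.
  by move=> xu xi xj; apply: contra xu => /S_meet/setP/(_ x); rewrite !inE xi xj => <-.
move=> xu xi xj; apply/val_inj/eqP; have := meet i j xu xi xj; have := meet j i xu xj xi.
by case: ltngtP.
Qed.

(** Each edge lies inside one part, and an end other than [u] determines that part. *)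
Lemma attached_branches J : attached G u (branches J).
Proof.
split=> [|x y]; first by rewrite !inE eqxx.
rewrite !inE => /andP[xu /bigcupP[i iJ xi]] yJ Gxy; apply/eqP.
apply: contraNT yJ => yu; rewrite yu; apply/bigcupP; exists i => //.
move: Gxy; rewrite -edgesP -S_edges => /bigcupP[j _]; rewrite inE => /andP[_].
rewrite finset.subUset !sub1set => /andP[xj yj].
by rewrite (part_eq xu xi xj).
Qed.

Lemma disjoint_branches J1 J2 : [disjoint J1 & J2] ->
  [disjoint branches J1 & branches J2].
Proof.
move=> dJ; rewrite disjoint_subset; apply/subsetP => x; rewrite !inE.
move=> /andP[xu /bigcupP[i iJ1 xi]]; rewrite xu; apply/bigcupP => -[j jJ2 xj].
by move: jJ2; rewrite -(part_eq xu xi xj) (disjointFr dJ iJ1).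
Qed.

(** Brings the set of moved neighbours into the form used by [relocate_mu_lt]. *)
Lemma bigcup_induced_nbrs J : (forall i, u \in S i) ->
  \bigcup_(i in J) induced_nbrs G (S i) u = [set w in branches J | G u w].
Proof.
move=> uS; apply/setP => w; rewrite !inE; apply/bigcupP/andP => [[i iJ]|].
  rewrite inE uS => /andP[wi Guw]; split=> //; apply/andP; split.
    by apply: contraTneq Guw => ->; rewrite (adj_irr G).
  by apply/bigcupP; exists i.
case=> /andP[_ /bigcupP[i iJ wi]] Guw; exists i => //.
by rewrite inE wi uS.
Qed.

Lemma mem_branches1 i x : x \in S i :\ u -> x \in branches [set i].
Proof. by rewrite /branches big_set1. Qed.

End Decomposition.

(* S i is the vertex set of the induced subgraph usually written G_(i+1).
   Cross edges between these subgraphs are excluded by S_edges: without it, the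
   triangle on u, v1, v2 with a pendant vertex at u would be a counterexample. *)
Theorem theorem4p2 (R : realType) (alpha : R) (halpha : 0 <= alpha < 1)
    (T : finType) (G : sgraph T) (Gconn : connected_graph G)
    (k : nat) (hk : (3 <= k)%N) (S : 'I_k -> {set T}) (u : T)
    (S_nontrivial : forall i, (2 <= #|S i|)%N)
    (S_edge_disjoint : forall i j : 'I_k, (i < j)%N ->
       [disjoint induced_edges G (S i) & induced_edges G (S j)])
    (S_meet : forall i j : 'I_k, (i < j)%N -> S i :&: S j = [set u])
    (S_vertices : \bigcup_(i : 'I_k) S i = [set: T])
    (S_edges : \bigcup_(i : 'I_k) induced_edges G (S i) = edges G)
    (i1 i2 : 'I_k) (hi1 : nat_of_ord i1 = 0%N) (hi2 : nat_of_ord i2 = 1%N)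
    (K : {set 'I_k}) (K_nonempty : K != set0)
    (K_ge : forall i, i \in K -> (2 <= i)%N)
    (v1 v2 : T) (hv1 : v1 \in S i1 :\ u) (hv2 : v2 \in S i2 :\ u) :
  let NK := \bigcup_(i in K) induced_nbrs G (S i) u in
  let G' := add_edges (del_edges G [set [set u; w] | w in NK])
                      [set [set v1; w] | w in NK] in
  let G'' := add_edges (del_edges G [set [set u; w] | w in NK])
                       [set [set v2; w] | w in NK] in
  mu_alpha alpha G < mu_alpha alpha G' \/ mu_alpha alpha G < mu_alpha alpha G''.

Proof.
(* Any other index gives a pairwise intersection containing [u]: [i1] serves for [i] different from
   [i1], and [i2] for [i1] itself. *)
have uS i : u \in S i.
  have mem_meet (i' j' : 'I_k) : (i' < j')%N -> u \in S i' /\ u \in S j'.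
    by move=> /S_meet/setP/(_ u); rewrite !inE eqxx => /andP.
  case: (ltngtP i i1) => [/mem_meet[]//|/mem_meet[]//|/val_inj ->].
  have /mem_meet[] // : (i1 < i2)%N by rewrite hi1 hi2.
move=> NK; rewrite {}/NK (bigcup_induced_nbrs G K uS).
have dK (i : 'I_k) : (i < 2)%N -> [disjoint K & [set i]].
  move=> lt_i; rewrite disjoint_sym disjoints1.
  by apply: contraL lt_i => /K_ge; rewrite leqNgt.
have d12 : [disjoint [set i1] & [set i2]].
  by rewrite disjoints1 inE -val_eqE /= hi1 hi2.
have A0 : branches S u K != set0.
  have /set0Pn[i iK] := K_nonempty.
  have : (0 < #|S i :\ u|)%N by have := S_nontrivial i; rewrite (cardsD1 u) uS.
  case/card_gt0P => w; rewrite !inE => /andP[wu wi].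
  by apply/set0Pn; exists w; rewrite !inE wu; apply/bigcupP; exists i.
apply: (relocate_mu_lt halpha Gconn A0 (attached_branches S_meet S_edges K)
  (attached_branches S_meet S_edges [set i1]) (attached_branches S_meet S_edges [set i2])).
- by apply: (disjoint_branches S_meet); rewrite dK ?hi1.
- by apply: (disjoint_branches S_meet); rewrite dK ?hi2.
- exact: (disjoint_branches S_meet).
- exact: mem_branches1.
- exact: mem_branches1.
Qed.
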